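(* Let $p\in\mathbf{P}$ be a propositional variable. The formula $[\neg\bullet p]\neg\bullet p$ is provable in $\mathbf{M}^{\circ[\cdot]}$.
   Context: Fix a nonempty set $\mathbf{P}$ of propositional variables. The language is $\mathcal{L}(\bullet)$ extended with public announcements: $\varphi::=p\mid\neg\varphi\mid\varphi\land\varphi\mid\bullet\varphi\mid[\varphi]\varphi$ with $p\in\mathbf{P}$; other Boolean connectives are defined as usual and $\circ\varphi$ abbreviates $\neg\bullet\varphi$. The proof system $\mathbf{M}^{\circ[\cdot]}$ has as axioms all instances (in this language) of: propositional tautologies; $\circ\texttt{E}$: $\bullet\varphi\to\varphi$; $\circ\texttt{M}$: $\circ\varphi\land\varphi\to\circ(\varphi\lor\psi)$; and the reduction axioms $\texttt{AP}$: $[\psi]p\leftrightarrow(\psi\to p)$ for $p\in\mathbf{P}$; $\texttt{AN}$: $[\psi]\neg\varphi\leftrightarrow(\psi\to\neg[\psi]\varphi)$; $\texttt{AC}$: $[\psi](\varphi\land\chi)\leftrightarrow([\psi]\varphi\land[\psi]\chi)$; $\texttt{AA}$: $[\psi][\chi]\varphi\leftrightarrow[\psi\land[\psi]\chi]\varphi$; $\texttt{A}\bullet$: $[\psi]\bullet\varphi\leftrightarrow(\psi\to\bullet[\psi]\varphi)$. Its rules are modus ponens and $\texttt{RE}\circ$: from $\varphi\leftrightarrow\psi$ infer $\circ\varphi\leftrightarrow\circ\psi$. *)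

(* Defs.v *)
From Stdlib Require Import Bool.

Set Implicit Arguments.
Unset Strict Implicit.
Unset Printing Implicit Defensive.

Inductive form (P : Type) : Type :=
| Var (p : P)
| Neg (phi : form P)
| Conj (phi psi : form P)
| Bul (phi : form P)
| Ann (psi phi : form P).

Declare Scope form_scope.
Delimit Scope form_scope with form.
Bind Scope form_scope with form.

Notation "~ phi" := (Neg phi) : form_scope.
Notation "phi /\ psi" := (Conj phi psi) : form_scope.
Notation "• phi" := (Bul phi) (at level 75, right associativity) : form_scope.
Notation "[! psi ] phi" := (Ann psi phi)
  (at level 75, psi at level 200, right associativity,
   format "[! psi ] phi") : form_scope.

Definition Disj {P : Type} (phi psi : form P) : form P :=
  (~ (~ phi /\ ~ psi))%form.
Definition Imp {P : Type} (phi psi : form P) : form P :=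
  (~ (phi /\ ~ psi))%form.

Notation "phi \/ psi" := (Disj phi psi) : form_scope.
Notation "phi -> psi" := (Imp phi psi) : form_scope.

Definition Iff {P : Type} (phi psi : form P) : form P :=
  ((phi -> psi) /\ (psi -> phi))%form.
Definition Circ {P : Type} (phi : form P) : form P := (~ • phi)%form.

Notation "phi <-> psi" := (Iff phi psi) : form_scope.
Notation "∘ phi" := (Circ phi) (at level 75, right associativity) : form_scope.

(* Boolean evaluation in which every formula that is not a negation or a
   conjunction counts as an atom, with the truth value given by [v]. *)
Fixpoint beval {P : Type} (v : form P -> bool) (phi : form P) : bool :=
  match phi with
  | Neg chi => negb (beval v chi)
  | Conj chi psi => beval v chi && beval v psi
  | Var _ | Bul _ | Ann _ _ => v phi
  end.

(* Since the atoms are arbitrary non-Boolean formulas, these are exactly the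
   substitution instances of classical propositional tautologies. *)
Definition tautology {P : Type} (phi : form P) : Prop :=
  forall v : form P -> bool, beval v phi = true.

(* Provability in the system M°[.]; there is no announcement necessitation
   or replacement rule. *)
Inductive provable {P : Type} : form P -> Prop :=
| ax_taut (phi : form P) :
    tautology phi -> provable phi
| ax_circE (phi : form P) :
    provable (• phi -> phi)
| ax_circM (phi psi : form P) :
    provable (∘ phi /\ phi -> ∘ (phi \/ psi))
| ax_AP (psi : form P) (p : P) :
    provable ([! psi] Var p <-> (psi -> Var p))
| ax_AN (psi phi : form P) :
    provable ([! psi] ~ phi <-> (psi -> ~ [! psi] phi))
| ax_AC (psi phi chi : form P) :
    provable ([! psi] (phi /\ chi) <-> ([! psi] phi /\ [! psi] chi))
| ax_AA (psi chi phi : form P) :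
    provable ([! psi] [! chi] phi <-> [! psi /\ [! psi] chi] phi)
| ax_ABul (psi phi : form P) :
    provable ([! psi] • phi <-> (psi -> • [! psi] phi))
| rule_MP (phi psi : form P) :
    provable (phi -> psi) -> provable phi -> provable psi
| rule_REcirc (phi psi : form P) :
    provable (phi <-> psi) -> provable (∘ phi <-> ∘ psi).

(* Main.v *)
(** Write [a] for [~ • p]. By [AP] the formula [[a]p] amounts to [a -> p], that is
    [• p \/ p], which [∘E] collapses to [p]. Hence [∘[a]p] is equivalent to
    [∘ p], which is [a] itself, while [AN] and [A•] reduce the goal to
    [a -> ∘[a]p]. *)
Require Import Defs.

(** Truth table: [beval] treats every non-Boolean subformula as an atom, so fixing the values of [v]
    leaves a closed computation. *)
Ltac tauto_form :=
  apply ax_taut; let v := fresh "v" in intro v; simpl;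
  repeat match goal with |- context [v ?f] => destruct (v f) end;
  reflexivity.

Lemma announced_atom (P : Type) (p : P) :
  provable ([! ~ • Var p] Var p <-> Var p).
Proof.
  (* The hole is the curried implication from both axioms to the goal. *)
  refine (rule_MP (rule_MP _ (ax_AP (~ • Var p) p)) (ax_circE (Var p))).
  tauto_form.
Qed.

Theorem proposition6p5 (P : Type) (p : P) :
  provable ([! ~ • Var p] ~ • Var p).
Proof.
  (* [∘ Var p] unfolds to the announced formula, so when that holds, [rule_REcirc] refutes [•
     [! ~ • Var p] Var p]; the rest is propositional. *)
  refine (rule_MP (rule_MP (rule_MP _ (ax_AN (~ • Var p) (• Var p)))
                           (ax_ABul (~ • Var p) (Var p)))
                  (rule_REcirc (announced_atom P p))).
  tauto_form.
Qed.
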